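(* There do not exist $p(x),q(x) \in \mathcal P$ with $q(x) \mid p(x)$ such that $34 = \frac{p(3)}{q(3)}$; that is, all representations of $34$ are local.
   Context: $\mathcal P$ denotes the set of Newman polynomials, i.e. polynomials with all coefficients in $\{0,1\}$ and constant term $1$ (including the constant polynomial $1$). A representation of an integer $m\equiv 1\pmod 3$ is an expression $m=\frac{p(3)}{q(3)}$ with $p(x),q(x)\in\mathcal P$. The representation is universal if $q(x)\mid p(x)$ (as polynomials), and local if $q(x)\nmid p(x)$. *)

(* Defs.v *)
From mathcomp Require Import all_boot all_order all_algebra.

Set Implicit Arguments.
Unset Strict Implicit.
Unset Printing Implicit Defensive.

Import GRing.Theory Num.Theory.
Local Open Scope ring_scope.

(* Coefficients are taken in rat, so that p(3) / q(3) is an actual quotient and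
   %| is exact divisibility.  Newman polynomials are monic with integer
   coefficients, so divisibility in Q[x] and in Z[x] coincide for them. *)
Definition newman (p : {poly rat}) : Prop :=
  (forall i : nat, p`_i = 0 \/ p`_i = 1) /\ p`_0 = 1.

(* The congruence m = 1 (mod 3) is not a separate clause: p(3) and q(3) are both
   1 modulo 3, so it follows from the equation. *)
Definition representation (m : int) (p q : {poly rat}) : Prop :=
  [/\ newman p, newman q & m%:~R = p.[3] / q.[3]].

Definition local_representation (m : int) (p q : {poly rat}) : Prop :=
  representation m p q /\ ~~ (q %| p).

(* Main.v *)
Require Import Defs.
From mathcomp Require Import all_boot all_order all_algebra.
From mathcomp Require Import zify lra.

(** Comparing sizes at 3, a quotient h = p / q of Newman polynomials with
    h(3) = 34 must be a cubic. Since h is monic with h(0) = 1 and its linear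
    coefficient p_1 - q_1 lies in {-1, 0, 1}, the value at 3 and integrality of
    the quadratic coefficient force h = x^3 + x^2 - x + 1. Then p = h q
    determines the low coefficients of q, and the coefficient of x^4 in h q is
    at least 2. *)

Set Implicit Arguments.
Unset Strict Implicit.
Unset Printing Implicit Defensive.

Import Order.TTheory GRing.Theory Num.Theory.
Local Open Scope ring_scope.

Lemma newman_neq0 (p : {poly rat}) : newman p -> p != 0.
Proof.
by move=> [_ p0]; apply/eqP => pE; move: p0; rewrite pE coef0 => /esym/eqP;
  rewrite oner_eq0.
Qed.

Lemma newman_monic (p : {poly rat}) : newman p -> p \is monic.
Proof.
move=> np; have := newman_neq0 np; rewrite -lead_coef_eq0 monicE.
by rewrite lead_coefE; case: (np.1 (size p).-1) => ->; rewrite eqxx.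
Qed.

(** The leading term alone contributes this power, and the other terms are nonnegative. *)
Lemma newman_horner3_ge (p : {poly rat}) :
  newman p -> 3 ^+ (size p).-1 <= p.[3].
Proof.
move=> np; have := newman_neq0 np; rewrite -size_poly_gt0 horner_coef.
have := newman_monic np; rewrite monicE lead_coefE => /eqP.
case: (size p) => // n /= lp _; rewrite big_ord_recr /= lp mul1r.
rewrite lerDr sumr_ge0 // => i _.
by case: (np.1 i) => ->; rewrite ?mul0r // mul1r exprn_ge0.
Qed.

(** The extreme case has all coefficients 1, where the geometric sum gives
    [(3 ^+ size p - 1) / 2]. *)
Lemma newman_horner3_lt (p : {poly rat}) :
  newman p -> 2 * p.[3] < 3 ^+ size p.
Proof.
move=> np; rewrite horner_coef.
have le_sum : \sum_(i < size p) p`_i * 3 ^+ i <= \sum_(i < size p) 3 ^+ i.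
  apply: ler_sum => i _.
  by case: (np.1 i) => ->; rewrite ?mul1r // mul0r exprn_ge0.
have := subrX1 (3 : rat) (size p).
set S := \sum_(i < _) 3 ^+ i in le_sum *; set T := \sum_(i < _) _ in le_sum *.
lra.
Qed.

Lemma size_newman_quotient34 (q h : {poly rat}) :
  newman (h * q) -> newman q -> h.[3] = 34 -> size h = 4%N.
Proof.
move=> np nq h3.
have q_neq0 := newman_neq0 nq.
have h_neq0 : h != 0.
  by apply: contraNneq (newman_neq0 np) => ->; rewrite mul0r.
have := newman_horner3_lt np; have := newman_horner3_ge np.
have := newman_horner3_lt nq; have := newman_horner3_ge nq.
rewrite hornerM h3 (size_mul h_neq0 q_neq0).
move: q_neq0 h_neq0; rewrite -!size_poly_gt0 => /prednK <- /prednK <-.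
move: (size q).-1 (size h).-1 => n d.
rewrite /= addnS /= !exprS exprD.
have : (0 : rat) < 3 ^+ n by rewrite exprn_gt0.
move: (3 ^+ n) q.[3] => t y t_gt0 ty yt dy yd.
(* Here [t <= y < 3 * t / 2]. The bounds on [34 * y] give [68 * t <= 68 * y < 3 * 3 ^ d * t] and
   [3 ^ d * t <= 34 * y < 51 * t]. The only power of 3 strictly between 22 and 51 is 27. *)
have d_gt : (22 < 3 ^ d)%N by rewrite -(ltr_nat rat) natrX; nra.
have d_lt : (3 ^ d < 51)%N by rewrite -(ltr_nat rat) natrX; nra.
clear dy yd; case: d d_gt d_lt => [|[|[|[|d]]]] //.
by have := expn_gt0 3 d; rewrite !expnS; lia.
Qed.

Lemma no_newman_quotient34 (q h : {poly rat}) :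
  newman (h * q) -> newman q -> h.[3] != 34.
Proof.
move=> np nq; apply/eqP => h3.
have sh := size_newman_quotient34 np nq h3.
have h_3 : h`_3 = 1.
  have := newman_monic np; rewrite (monicMr _ (newman_monic nq)) monicE.
  by rewrite lead_coefE sh => /eqP.
have h_4 : h`_4 = 0 by rewrite nth_default ?sh.
move: h3; rewrite horner_coef sh !big_ord_recr big_ord0 /= h_3.
have := np.2; have := np.1 1; have := np.1 2; have := np.1 3; have := np.1 4.
rewrite !coefMr !big_ord_recr !big_ord0 /= !subn0 !subnn h_3 h_4 nq.2.
rewrite /subn /=.
have := nq.1 1; have := nq.1 2; have := nq.1 3; have := nq.1 4.
move: h`_0 h`_1 h`_2 q`_1 q`_2 q`_3 q`_4 => c b a q1 q2 q3 q4.
rewrite !exprS expr0 => q4E q3E q2E q1E p4E p3E p2E p1E p0E h3.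
have c1 : c = 1 by lra.
have bE : b = 2 - 3 * a by lra.
(* A priori [h] has only rational coefficients. Since [b + q1] is 0 or 1, [b] is -1, 0 or 1, so [a]
   is 1, 2/3 or 1/3. The coefficient [a + b * q1 + q2] of the product must be an integer, which
   excludes the fractions; then [b = -1] forces [q1 = 1]. *)
have [q1_1 a1] : q1 = 1 /\ a = 1.
  by move: c1 bE p1E p2E => -> ->; case: q1E => ->; case: q2E => ->; lra.
(* The coefficient of x^3 is now [2 - q2 + q3], so [q2 = 1] and [q3 = 0]; that of x^4 is then
   [2 + q4], which is too large. *)
move: c1 bE p2E p3E p4E; rewrite {}a1 {}q1_1 => -> ->.
by case: q2E => ->; case: q3E => ->; case: q4E => ->; lra.
Qed.

Theorem corollary3p2 :
  (~ exists p q : {poly rat},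
       [/\ newman p, newman q, q %| p & 34 = p.[3] / q.[3]]) /\
  (forall p q : {poly rat},
     representation 34 p q -> local_representation 34 p q).
Proof.
have not_dvd (p q : {poly rat}) :
    newman p -> newman q -> 34 = p.[3] / q.[3] -> ~~ (q %| p).
  move=> np nq pq; apply/negP => /dvdpP [h pE]; rewrite {}pE in np pq.
  have q3_neq0 : q.[3] != 0.
    by rewrite gt_eqF // (lt_le_trans _ (newman_horner3_ge nq)) ?exprn_gt0.
  move: (no_newman_quotient34 np nq) pq.
  by rewrite hornerM mulfK // => /eqP h3 /esym.
split=> [[p [q [np nq qp pq]]]|p q rpq].
  by move/negP: (not_dvd p q np nq pq).
by split=> //; case: rpq => np nq; apply: not_dvd.
Qed.
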